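(* Let $b\ge2$ and $n\ge2$ be integers, let $B_1,\dots,B_n$ be independent and uniformly distributed on $\{0,1,\dots,b-1\}$, and for $1\le i\le n-1$ let $X_i=1$ if $B_i>B_{i+1}$ and $X_i=0$ otherwise. Let $\epsilon_1,\epsilon_2,\dots,\epsilon_{n-1}$ be a fixed sequence in $\{0,1\}$ with exactly $k$ ones, at positions $s_1<s_2<\dots<s_k$, and set $s_0=0$, $s_{k+1}=n$. Then $$P\{X_1=\epsilon_1,\dots,X_{n-1}=\epsilon_{n-1}\}=\frac1{b^n}\det\left[\binom{s_{j+1}-s_i+b-1}{b-1}\right]_{i,j=0}^{k}.$$
   Context: The determinant is of a $(k+1)\times(k+1)$ matrix, rows and columns indexed by $0\le i,j\le k$; an entry $\binom{s_{j+1}-s_i+b-1}{b-1}$ with $s_{j+1}<s_i$ is taken to be $0$. *)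

(* Defs.v *)
From HB Require Import structures.
From mathcomp Require Import all_boot all_order all_algebra.
From mathcomp Require Import all_classical all_reals all_analysis.

Set Implicit Arguments.
Unset Strict Implicit.
Unset Printing Implicit Defensive.

Import Order.TTheory GRing.Theory Num.Theory.

Local Open Scope classical_set_scope.
Local Open Scope ring_scope.

(* Mutual independence of the subfamily (X i), i in D: the product rule for
   every finite set J of indices in D and all measurable sets A i. *)
Definition mutually_independent (d d' : measure_display)
    (T : measurableType d) (T' : measurableType d') (R : realType)
    (P : probability T R) (I : choiceType) (D : set I)
    (X : I -> {RV P >-> T'}) : Prop :=
  forall (J : seq I) (A : I -> set T'),
    uniq J -> [set` J] `<=` D -> (forall i, measurable (A i)) ->
    P (\bigcap_(i in [set` J]) (X i @^-1` A i)) =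
      (\prod_(i <- J) P (X i @^-1` A i))%E.

Definition uniform_below (d : measure_display) (T : measurableType d)
    (R : realType) (P : probability T R) (b : nat) (X : {RV P >-> nat}) : Prop :=
  forall c : nat,
    distribution P X [set c] = (if (c < b)%N then b%:R^-1 else 0)%:E.

(* The value 1 of the descent indicator is [true], the value 0 is [false]. *)
Definition descent (T : Type) (B : nat -> T -> nat) (i : nat) (t : T) : bool :=
  (B i.+1 t < B i t)%N.

(* The convention s 0 = 0 and s k.+1 = n is part of the definition; only the
   values eps m with 1 <= m <= n - 1 and s i with i <= k.+1 matter. *)
Definition positions_of_ones (n : nat) (eps : nat -> bool) (k : nat)
    (s : nat -> nat) : Prop :=
  [/\ s 0%N = 0%N,
      s k.+1 = n,
      (forall i, (1 <= i <= k)%N -> (1 <= s i <= n - 1)%N),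
      (forall i j, (1 <= i)%N -> (i < j)%N -> (j <= k)%N -> (s i < s j)%N) &
      forall m, (1 <= m <= n - 1)%N ->
        (eps m <-> exists2 i, (1 <= i <= k)%N & s i = m)].

(* The guard is needed because subtraction on nat is truncated: without it,
   the entries with s j.+1 < s i would be 'C(b - 1, b - 1) = 1. *)
Definition descent_mx (R : realType) (b k : nat) (s : nat -> nat) :
    'M[R]_k.+1 :=
  \matrix_(i < k.+1, j < k.+1)
    (if (s j.+1 < s i)%N then 0
     else ('C(s j.+1 - s i + b - 1, b - 1))%:R).

(* Main.v *)
Require Import Defs.
From HB Require Import structures.
From mathcomp Require Import all_boot all_order all_algebra.
From mathcomp Require Import all_classical all_reals all_analysis.
From mathcomp Require Import zify.

Import Order.TTheory GRing.Theory Num.Theory.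

(* Let N(s_1..s_k; n) be the number of words of length n over b letters with
   descents exactly at s_1, .., s_k. A word whose first s_k letters have
   descents s_1, .., s_(k-1) and whose last n - s_k letters are weakly
   increasing either descends at s_k or does not, so
     N(s_1..s_(k-1); s_k) * 'C(n - s_k + b - 1, b - 1)
       = N(s_1..s_k; n) + N(s_1..s_(k-1); n).
   Expanding the Hessenberg determinant along its last row gives the same
   recursion. Almost surely the B_i form a word over b letters, and each such
   word has probability b^-n. *)

(** Positions count from 1 while [nth] counts from 0: position [i] compares the letters of indices
    [i.-1] and [i], so only the values of [D] at [1 .. size w - 1] matter. *)
Definition has_descent_set (D : pred nat) (w : seq nat) : bool :=
  all (fun i => (nth 0 w i < nth 0 w i.-1) == D i) (iota 1 (size w).-1).

Definition descent_count (b n : nat) (D : pred nat) : nat :=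
  #|[set w : n.-tuple 'I_b | has_descent_set D (map val w)]|.

Lemma has_descent_setP (D : pred nat) (w : seq nat) :
  reflect (forall i, 0 < i -> i < size w -> (nth 0 w i < nth 0 w i.-1) = D i)
    (has_descent_set D w).
Proof.
apply: (iffP allP) => [H i i0 iw|H i].
  by apply: (eqP (H i _)); rewrite mem_iota; lia.
by rewrite mem_iota => /andP[i0 iw]; rewrite H ?eqxx//; lia.
Qed.

Lemma has_descent_set0 (w : seq nat) : has_descent_set pred0 w = sorted leq w.
Proof.
apply/has_descent_setP/(sortedP 0) => H i; last first.
  by case: i => // i _ iw; apply/negbTE; rewrite -leqNgt H.
by move=> iw; have /negbT := H i.+1 isT iw; rewrite -leqNgt.
Qed.

(** Weakly increasing words of length [n] correspond to multisets of [n] letters. *)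
Lemma descent_count0 (b n : nat) : 0 < b ->
  descent_count b n pred0 = 'C(n + b - 1, b - 1).
Proof.
case: b => // b _; rewrite addnS !subn1 /= -[RHS]bin_sub ?leq_addl// addnK.
rewrite -card_sorted_tuples; apply: eq_card => w.
by rewrite !inE has_descent_set0.
Qed.

Lemma card_cat_tuple (T : finType) (p q : nat) (A B : pred (seq T)) :
  #|[set w : (p + q).-tuple T | A (take p w) && B (drop p w)]| =
  #|[set u : p.-tuple T | A u]| * #|[set v : q.-tuple T | B v]|.
Proof.
rewrite -cardsX.
pose f (x : p.-tuple T * q.-tuple T) := cat_tuple x.1 x.2.
have f_inj : injective f.
  move=> [u v] [u' v'] /(congr1 val)/= /eqP.
  by rewrite eqseq_cat ?size_tuple// => /andP[/eqP/val_inj -> /eqP/val_inj ->].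
rewrite -(card_imset _ f_inj); apply: eq_card => w; rewrite inE.
apply/idP/imsetP => [Aw|[[u v]]]; last first.
  by rewrite inE => /= uv ->; rewrite take_size_cat ?drop_size_cat ?size_tuple// !inE in uv *.
have tw : size (take p w) == p by rewrite size_takel// size_tuple leq_addr.
have dw : size (drop p w) == q by rewrite size_drop size_tuple addKn.
exists (Tuple tw, Tuple dw); first by rewrite !inE.
by apply: val_inj; rewrite /= cat_take_drop.
Qed.

(* Cutting a word at its last prescribed descent [p]: whether the two letters
   around the cut descend or not is left free on the right-hand side. *)
Lemma descent_count_cut (b p q : nat) (D : pred nat) : 0 < p -> 0 < q ->
    (forall i, D i -> i < p) ->
  descent_count b (p + q) (predU1 p D) + descent_count b (p + q) D =
  descent_count b p D * descent_count b q pred0.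
Proof.
move=> p0 q0 Dp.
pose A D (w : seq 'I_b) := has_descent_set D (map val w).
rewrite -[RHS](@card_cat_tuple _ p q (A D) (A pred0)) /descent_count -cardsUI.
(* The two sets of words are disjoint: one demands a descent at [p], the other forbids it, as [D]
   holds only below [p]. *)
set I := _ :&: _; have -> : I = finset.set0.
  apply/setP => w; rewrite !inE; apply/negbTE/negP => /andP[].
  move=> /has_descent_setP/(_ p) + /has_descent_setP/(_ p).
  rewrite size_map size_tuple /= eqxx /= => -> //; last lia.
  by move=> /(_ p0 ltac:(lia)) /esym/Dp; rewrite ltnn.
rewrite cards0 addn0; apply: eq_card => w; rewrite !inE /A map_take map_drop.
have : size (map val w) = p + q by rewrite size_map size_tuple.
move: (map val w) => {I A}w sw.
have st : size (take p w) = p by rewrite size_takel// sw leq_addr.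
have sd : size (drop p w) = q by rewrite size_drop sw addKn.
apply/idP/andP => [|[/has_descent_setP]].
  move=> Dw; have {}Dw i : 0 < i -> i < p + q -> i != p ->
      (nth 0 w i < nth 0 w i.-1) = D i.
    move=> i0 ipq ip; case/orP: Dw => /has_descent_setP/(_ i i0); rewrite sw ipq.
      by move=> -> //=; rewrite /predU1 /= (negbTE ip).
    exact.
  split; apply/has_descent_setP => i i0.
    by rewrite st => ip; rewrite !nth_take ?Dw//; lia.
  rewrite sd => iq; rewrite !nth_drop.
  have -> : p + i.-1 = (p + i).-1 by lia.
  have [pi0 piq pip] : [/\ 0 < p + i, p + i < p + q & p + i != p] by split; lia.
  by rewrite Dw//=; apply/negbTE/negP => /Dp; rewrite ltnNge leq_addr.
rewrite st => Ht /has_descent_setP; rewrite sd => Hd.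
(* Beyond the cut [D] is false, which is what the weakly increasing second half provides. *)
have Dw i : 0 < i -> i < p + q -> i != p ->
    (nth 0 w i < nth 0 w i.-1) = D i.
  move=> i0 ipq ip; case: (ltnP i p) => ip'.
    by rewrite -Ht// !nth_take//; lia.
  have Di : D i = false by apply/negbTE/negP => /Dp; rewrite ltnNge ip'.
  have [ip0 ipq0] : 0 < i - p /\ i - p < q by lia.
  have := Hd _ ip0 ipq0; rewrite !nth_drop Di subnKC//.
  by rewrite (_ : p + (i - p).-1 = i.-1)//; lia.
(* Only position [p] is left undetermined; it decides which of the two sets contains the word. *)
apply/orP; case Ep: (nth 0 w p < nth 0 w p.-1); [left|right];
  apply/has_descent_setP => i i0; rewrite sw => ipq;
  rewrite /=; case: (eqVneq i p) => [->|ip] //=; rewrite ?Ep ?Dw//.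
by apply/esym/negbTE/negP => /Dp; rewrite ltnn.
Qed.

Lemma eq_descent_count (b n : nat) (D D' : pred nat) :
  (forall i, 0 < i < n -> D i = D' i) ->
  descent_count b n D = descent_count b n D'.
Proof.
move=> DD'; apply: eq_card => w; rewrite !inE; apply: eq_in_all => i.
by rewrite mem_iota size_map size_tuple => iw; rewrite DD'//; lia.
Qed.

Local Open Scope classical_set_scope.
Local Open Scope ring_scope.

(* The matrix is upper Hessenberg with ones below the diagonal, so its last row
   has two nonzero entries; striking out the row and the column [k] amounts to
   deleting the position [s k.+1] from the sequence. *)
Lemma det_descent_mxS (R : realType) (b k : nat) (s : nat -> nat) :
    (forall j, (j <= k)%N -> (s j < s k.+1)%N) -> (s k.+1 <= s k.+2)%N ->
  \det (descent_mx R b k.+1 s) =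
    'C(s k.+2 - s k.+1 + b - 1, b - 1)%:R * \det (descent_mx R b k s)
    - \det (descent_mx R b k (fun i => if i == k.+1 then s k.+2 else s i)).
Proof.
move=> s_lt s_le; rewrite (expand_det_row _ ord_max) !big_ord_recr/= big1 => [|j _].
  rewrite add0r addrC !mxE/= ltnNge s_le/= ltnn subnn add0n binn mul1r.
  (* The diagonal cofactor has an even sign exponent; the one left of it has an odd exponent, whence
     the minus sign, and its entry is ['C(b - 1, b - 1)], that is 1. *)
  rewrite /cofactor /= addnn -signr_odd odd_double expr0 mul1r.
  rewrite addSn addnn -signr_odd /= odd_double expr1 mulN1r.
  congr (_ * _ - _); congr determinant; apply/matrixP => i j; rewrite !mxE !lift_max//.
  (* Once column [k] is struck out, the last column of the minor reads [s k.+2], the value of the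
     modified sequence at [k.+1]. No row index reaches [k.+1]. *)
  rewrite /= /bump (ltn_eqF (ltn_ord i)) eqSS.
  case: (ltngtP k j) => kj.
  - by have := ltn_ord j; rewrite ltnS leqNgt kj.
  - by rewrite add0n.
  - by rewrite add1n -kj.
by rewrite !mxE/= s_lt ?mul0r.
Qed.

(** The induction on [k] keeps [s] general, because the hypothesis is applied both to [s], for words
    of length [s k.+1], and to the modified sequence [s'], for words of length [s k.+2] with the
    same prescribed descents. *)
Lemma descent_count_det (R : realType) (b k : nat) (s : nat -> nat) :
    (0 < b)%N -> s 0%N = 0%N ->
    (forall i j, (i < j)%N -> (j <= k.+1)%N -> (s i < s j)%N) ->
  (descent_count b (s k.+1) (fun m => m \in [seq s i | i <- iota 1 k]))%:R =
    \det (descent_mx R b k s).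
Proof.
move=> b0 s0; elim: k s s0 => [|k IHk] s s0 s_lt.
  by rewrite det_mx11 !mxE /= s0 ltn0 subn0 -descent_count0.
rewrite det_descent_mxS; first last.
- by rewrite ltnW// s_lt.
- by move=> j jk; rewrite s_lt.
have Dp i : i \in [seq s i | i <- iota 1 k] -> (i < s k.+1)%N.
  by move=> /mapP[j]; rewrite mem_iota => jk ->; apply: s_lt; lia.
have p0 : (0 < s k.+1)%N by rewrite -s0 s_lt.
have q0 : (0 < s k.+2 - s k.+1)%N by rewrite subn_gt0 s_lt.
have := descent_count_cut b _ _ _ p0 q0 Dp.
rewrite subnKC; last by rewrite ltnW// s_lt.
move=> /(congr1 (fun m => m%:R : R)); rewrite natrD natrM descent_count0//.
rewrite IHk//; last by move=> i j ij jk; apply: s_lt => //; lia.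
set s' := fun i => if _ then _ else s i.
have Es' i : (i <= k)%N -> s' i = s i by rewrite /s'; case: eqP => // ->; rewrite ltnn.
have := IHk s'; rewrite (Es' 0%N isT) => /(_ s0) <-; last first.
  move=> i j ij jk; rewrite (Es' i); last lia.
  by rewrite /s'; case: eqP => [_|_]; apply: s_lt; lia.
rewrite {1}/s' eqxx.
have -> : [seq s' i | i <- iota 1 k] = [seq s i | i <- iota 1 k].
  by apply/eq_in_map => i; rewrite mem_iota => ik; apply: Es'; lia.
rewrite mulrC => <-; rewrite addrK; congr (1 *+ _); apply: eq_descent_count => i _.
by rewrite -[in LHS](addn1 k) iotaD map_cat mem_cat /= mem_seq1 add1n orbC.
Qed.

Lemma probability_word (R : realType) (d : measure_display)
    (T : measurableType d) (P : probability T R) (b n : nat)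
    (B : nat -> {RV P >-> nat}) (w : seq nat) :
    mutually_independent [set i | (1 <= i <= n)%N] B ->
    (forall i, (1 <= i <= n)%N -> uniform_below b (B i)) ->
    size w = n -> all (fun c => c < b)%N w ->
  measurable [set t | [seq B i t | i <- iota 1 n] = w] /\
  P [set t | [seq B i t | i <- iota 1 n] = w] = (b%:R^-1 ^+ n)%:E.
Proof.
move=> B_ind B_unif sw wb.
(* As an intersection of events on single letters, the event falls under the product rule; the
   letter [B i] sits at index [i.-1] of [w]. *)
have -> : [set t | [seq B i t | i <- iota 1 n] = w] =
    \bigcap_(i in [set` iota 1 n]) (B i @^-1` [set nth 0%N w i.-1]).
  apply/seteqP; split => t /= Bw.
    move=> i; rewrite /= mem_iota => i_n; rewrite -Bw (nth_map 0%N) ?size_iota; last lia.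
    by rewrite nth_iota; [congr (B _ t)|]; lia.
  apply: (@eq_from_nth _ 0%N); first by rewrite size_map size_iota sw.
  move=> i; rewrite size_map size_iota => i_n.
  rewrite (nth_map 0%N) ?size_iota// nth_iota//.
  by rewrite Bw//= mem_iota; lia.
have mw i : measurable [set nth 0%N w i.-1] by [].
split.
  apply: fin_bigcap_measurable => [|i _]; first exact: finite_seq.
  by rewrite -[X in measurable X]setTI; exact: measurable_funP.
rewrite (B_ind _ (fun i => [set nth 0%N w i.-1])) ?iota_uniq//; last first.
  by move=> i /=; rewrite mem_iota; lia.
rewrite (eq_big_seq (fun=> (b%:R^-1)%:E)) => [|i]; last first.
  rewrite mem_iota => i_n; have i1 : (1 <= i <= n)%N by lia.
  have := B_unif i i1 (nth 0%N w i.-1); rewrite /distribution /pushforward => ->.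
  by rewrite (allP wb)// mem_nth// sw; lia.
by rewrite prodEFin big_const_seq count_predT size_iota iter_mulr_1.
Qed.

(** The [B i] take values in [nat], so their letters lie below [b] only almost surely. The event is
    therefore first restricted to the union [U] of the word events, on which it is a finite disjoint
    union. *)
Lemma probability_uniform_words (R : realType) (d : measure_display)
    (T : measurableType d) (P : probability T R) (b n : nat)
    (B : nat -> {RV P >-> nat}) (A : pred (seq nat)) :
    (0 < b)%N ->
    mutually_independent [set i | (1 <= i <= n)%N] B ->
    (forall i, (1 <= i <= n)%N -> uniform_below b (B i)) ->
    measurable [set t | A [seq B i t | i <- iota 1 n]] ->
  P [set t | A [seq B i t | i <- iota 1 n]] =
    (#|[set w : n.-tuple 'I_b | A (map val w)]%SET|%:R * b%:R^-1 ^+ n)%:E.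
Proof.
move=> b0 B_ind B_unif mA.
pose W (w : n.-tuple 'I_b) := [set t | [seq B i t | i <- iota 1 n] = map val w].
have Ww w : measurable (W w) /\ P (W w) = (b%:R^-1 ^+ n)%:E.
  apply: probability_word => //; first by rewrite size_map size_tuple.
  by apply/allP => _ /mapP[c _ ->]; exact: ltn_ord.
have tW D : trivIset D W.
  move=> u v _ _ [t [/= Eu Ev]]; apply/val_inj/(inj_map val_inj).
  by rewrite -[LHS]Eu -[RHS]Ev.
have mU (X : {set n.-tuple 'I_b}) : measurable (\bigcup_(w in [set` X]) W w).
  by apply: fin_bigcup_measurable => [|w _]; [exact: finite_finpred|exact: (Ww w).1].
have PU (X : {set n.-tuple 'I_b}) :
    P (\bigcup_(w in [set` X]) W w) = (#|X|%:R * b%:R^-1 ^+ n)%:E.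
  rewrite measure_fin_bigcup//; last by move=> w _; exact: (Ww w).1.
  have -> : [set` X] = [set` enum X] by apply/seteqP; split => w /=; rewrite mem_enum.
  rewrite -fsbig_seq ?enum_uniq// (eq_bigr (fun=> (b%:R^-1 ^+ n)%:E)) => [|w _]; last exact: (Ww w).2.
  by rewrite sumEFin big_enum/= sumr_const mulr_natl.
pose U := \bigcup_(w in [set` [set: n.-tuple 'I_b]%SET]) W w.
have mUU : measurable U by exact: mU.
(* There are [b ^ n] words of probability [b ^ - n] each, so [U] has probability 1. *)
have PU1 : P (~` U) = 0%E.
  rewrite probability_setC// PU cardsT card_tuple card_ord natrX -exprMn.
  by rewrite mulfV ?pnatr_eq0 -?lt0n// expr1n subee.
set E := [set t | _] in mA *.
have PE0 : P (E `\` U) = 0%E.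
  apply: (subset_measure0 _ _ _ PU1); [exact: measurableD|exact: measurableC|].
  by move=> t [].
have -> : P E = P (E `&` U) by rewrite -[RHS]add0e -PE0; exact: measureDI.
rewrite -PU; congr (P _); apply/seteqP; split => t /=.
  by move=> [At [w _ /= Ew]]; exists w => //=; rewrite inE -Ew.
by move=> [w /=]; rewrite inE => Aw Ew; split; [rewrite /E/= Ew|exists w => //=; rewrite inE].
Qed.

Theorem fact5 (R : realType) (d : measure_display) (T : measurableType d)
    (P : probability T R) (b n : nat) (hb : (2 <= b)%N) (hn : (2 <= n)%N)
    (B : nat -> {RV P >-> nat})
    (hindep : mutually_independent [set i | (1 <= i <= n)%N] B)
    (hunif : forall i, (1 <= i <= n)%N -> uniform_below b (B i))
    (eps : nat -> bool) (k : nat) (s : nat -> nat)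
    (hs : positions_of_ones n eps k s) :
  P [set t | forall i, (1 <= i <= n - 1)%N -> descent B i t = eps i] =
    (1 / b%:R ^+ n * \det (descent_mx R b k s))%:E.
Proof.
have [s0 sn s_in s_lt s_eps] := hs; have b0 : (0 < b)%N by lia.
(* Strict monotonicity extends to the end values [s 0 = 0] and [s k.+1 = n], since the positions of
   ones lie strictly between them. *)
have s_inc i j : (i < j)%N -> (j <= k.+1)%N -> (s i < s j)%N.
  move=> ij jk; case: (posnP i) => [i0|i0]; case: (ltnP k j) => kj.
  - by rewrite i0 s0 (_ : j = k.+1) ?sn; lia.
  - by have := s_in j ltac:(lia); rewrite i0 s0; lia.
  - by have := s_in i ltac:(lia); rewrite (_ : j = k.+1) ?sn; lia.
  - exact: s_lt.
pose D : pred nat := fun m => m \in [seq s i | i <- iota 1 k].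
have DE m : (1 <= m <= n - 1)%N -> eps m = D m.
  move=> m_n; apply/idP/mapP => [/(s_eps m m_n)[i ik <-]|[i + ->]].
    by exists i => //; rewrite mem_iota; lia.
  rewrite mem_iota => ik; have ik' : (1 <= i <= k)%N by lia.
  by apply/(s_eps _ (s_in i ik')); exists i.
have EE : [set t | forall i, (1 <= i <= n - 1)%N -> descent B i t = eps i] =
    [set t | has_descent_set D [seq B i t | i <- iota 1 n]].
  apply/seteqP; split => t /=.
    move=> H; apply/has_descent_setP => i i0; rewrite size_map size_iota => i_n.
    have i_n1 : (1 <= i <= n - 1)%N by lia.
    rewrite -DE// -H// /descent !(nth_map 0%N) ?size_iota; try lia.
    by rewrite !nth_iota ?add1n ?prednK//; lia.
  move=> /has_descent_setP H i i_n1; rewrite DE// -H ?size_map ?size_iota; try lia.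
  rewrite /descent !(nth_map 0%N) ?size_iota; try lia.
  by rewrite !nth_iota ?add1n ?prednK//; lia.
(* Outside [U] the event need not be a union of word events, so its measurability comes from that of
   the comparisons between consecutive [B i]. *)
have mE : measurable [set t | forall i, (1 <= i <= n - 1)%N -> descent B i t = eps i].
  rewrite (_ : [set t | _] =
    \bigcap_(i in [set i | (1 <= i <= n - 1)%N]) (descent B i @^-1` [set eps i]))//.
  apply: bigcap_measurableType => i _; rewrite -[X in measurable X]setTI.
  have mB : measurable_fun setT (descent B i).
    by apply: measurable_realfun.measurable_fun_ltn; exact: measurable_funP.
  exact: mB.
rewrite EE in mE *; rewrite (probability_uniform_words _ _ _ P b n B _ b0)//.
by rewrite -descent_count_det// sn mul1r exprVn mulrC.
Qed.
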